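(* Let $\pi:\mathcal{X}\to\mathcal{B}$ be a functor, viewed as an object of the 2-category $Cat/\mathcal{B}$, and let $(T,y,m)$ be the opfibration monad on $Cat/\mathcal{B}$. 1) Assume that $\xi:T(\mathcal{X})\to\mathcal{X}$ is a morphism in $Cat/\mathcal{B}$ which is vertically left adjoint to $y_{\mathcal{X}}$ (i.e. $\xi\dashv y_{\mathcal{X}}$ in the 2-category $Cat/\mathcal{B}$), with the identity as counit (so $\xi\circ y_{\mathcal{X}}=\mathrm{id}_{\mathcal{X}}$). Then $\pi:\mathcal{X}\to\mathcal{B}$ carries a canonical structure of normalized cleavage, namely $X\triangleright a:=\xi((X,1_A);a)$ for $X\in\mathcal{X}$ with $\pi(X)=A$ and $a:A\to B$ in $\mathcal{B}$. Conversely, a normalized cleavage $\triangleright$ of $\pi$ defines a functor $\xi:T(\mathcal{X})\to\mathcal{X}$ over $\mathcal{B}$ (by the recipe $\triangleright\mapsto\xi$ given in the context) which is left adjoint to $y_{\mathcal{X}}$ in $Cat/\mathcal{B}$, with $\xi\circ y_{\mathcal{X}}=\mathrm{id}_{\mathcal{X}}$ and with identity counit. 2) For $\xi$ as in 1), the corresponding normalized cleavage is a splitting if and only if $\xi$ is strictly associative, i.e. $\xi\circ T(\xi)=\xi\circ m_{\mathcal{X}}$. 3) Let $(\mathcal{X},\xi)$ and $(\mathcal{X}',\xi')$ be strict $T$-algebras, with corresponding splittings $\triangleright$ and $\triangleright'$. Then a functor $F:\mathcal{X}\to\mathcal{X}'$ over $\mathcal{B}$ is a $T$-homomorphism (i.e.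 $F\circ\xi=\xi'\circ T(F)$) if and only if it preserves the splittings strictly, i.e. $F(X\triangleright a)=F(X)\triangleright' a$ for all $X\in\mathcal{X}$ and all arrows $a$ of $\mathcal{B}$ with domain $\pi(X)$.
   Context: Conventions: arrows in an abstract category are composed from left to right ($a.b$ means first $a$, then $b$); functors are composed from right to left ($G\circ F$ means first $F$, then $G$). For a functor $\pi:\mathcal{X}\to\mathcal{B}$, an arrow $x$ of $\mathcal{X}$ is ''over $a$'' if $\pi(x)=a$; an object $X$ is over $A$ if $\pi(X)=A$; $\hom_a(X,Y)$ is the set of arrows $X\to Y$ over $a$; an arrow is vertical if it is over an identity arrow. An arrow $x\in\hom_a(X,Y)$, $a:A\to B$, is cocartesian if for every arrow $b:B\to C$ of $\mathcal{B}$ and every $Z$ over $C$, precomposition with $x$ is a bijection $\hom_b(Y,Z)\to\hom_{a.b}(X,Z)$. Cleavages: a cleavage $\triangleright$ of $\pi$ is a choice, for every $X\in\mathcal{X}$ and every arrow $a$ of $\mathcal{B}$ with domain $\pi(X)$, of a cocartesian arrow $X\triangleright a$ over $a$ with domain $X$; its codomain is denoted $a_*(X)$. It is normalized if $X\triangleright 1_A=1_X$ whenever $\pi(X)=A$. It is a splitting if it is normalized and $(X\triangleright a).(a_*(X)\triangleright b)=X\triangleright(a.b)$ for all $X$ and composable $a,b$ with $a$ having domain $\pi(X)$. The 2-category $Cat/\mathcal{B}$: objects are functors $\pi:\mathcal{X}\to\mathcal{B}$ (abbreviated $\mathcal{X}$); morphisms $(\mathcal{X},\pi)\to(\mathcal{Y},\pi')$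 are functors $F$ with $\pi'\circ F=\pi$ (functors over $\mathcal{B}$); 2-cells are vertical natural transformations, i.e. all of whose components are vertical. An adjunction in $Cat/\mathcal{B}$ is an ordinary adjunction between functors over $\mathcal{B}$ whose unit and counit are vertical (''vertical adjunction''). The opfibration monad $(T,y,m)$: $T(\pi:\mathcal{X}\to\mathcal{B})$ is the comma category $\pi\downarrow\mathcal{B}$ with the codomain functor to $\mathcal{B}$. Its objects over $B$ are pairs $(X,a)$ with $X\in\mathcal{X}$ and $a:\pi(X)\to B$ in $\mathcal{B}$. An arrow $(X,a)\to(X',a')$ over $\beta:B\to B'$ is a pair $(x,\beta)$, where $x:X\to X'$ in $\mathcal{X}$ satisfies $\pi(x).a'=a.\beta$. On functors $F$ over $\mathcal{B}$, $T(F)(X,a)=(F(X),a)$ and $T(F)(x,\beta)=(F(x),\beta)$. The unit is $y_{\mathcal{X}}(X)=(X,1_{\pi(X)})$, $y_{\mathcal X}(x)=(x,\pi(x))$. Objects of $T^2(\mathcal{X})$ are $(X,a,b)$ with $a,b$ composable and $a$ having domain $\pi(X)$; $m_{\mathcal{X}}(X,a,b)=(X,a.b)$, and on arrows $m_{\mathcal{X}}(x,\beta,\gamma)=(x,\gamma)$. For $(X,a)$ over $B$ and $b:B\to C$, $((X,a);b):(X,a)\to(X,a.b)$ denotes the arrow $(1_X,b)$ over $b$ in $T(\mathcal{X})$. In particular $((X,1_A);a):(X,1_A)\to(X,a)$. The recipe $\triangleright\mapsto\xi$: $\xi(X,a):=a_*(X)$; for an arrow $(x,\beta):(X,a)\to(X',a')$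 of $T(\mathcal{X})$, $\xi(x,\beta)$ is the unique arrow $a_*(X)\to a'_*(X')$ over $\beta$ with $(X\triangleright a).\xi(x,\beta)=x.(X'\triangleright a')$. A strict $T$-algebra is an Eilenberg-Moore algebra: an object $\mathcal{X}$ of $Cat/\mathcal{B}$ with a morphism $\xi:T(\mathcal{X})\to\mathcal{X}$ in $Cat/\mathcal{B}$ such that $\xi\circ y_{\mathcal{X}}=\mathrm{id}$ and $\xi\circ T(\xi)=\xi\circ m_{\mathcal{X}}$. For such an algebra one has $\xi\dashv y_{\mathcal{X}}$ in $Cat/\mathcal{B}$ with identity counit, and the splitting corresponding to it is $X\triangleright a:=\xi((X,1_A);a)$. *)

(* Defs.v *)
From Stdlib Require Import ProofIrrelevance.

Set Implicit Arguments.
Unset Strict Implicit.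
Unset Printing Implicit Defensive.

Declare Scope cat_scope.
Open Scope cat_scope.

Record Category := {
  ob :> Type;
  hom : ob -> ob -> Type;
  idm : forall A, hom A A;
  comp : forall A B C, hom A B -> hom B C -> hom A C;
  comp_idl : forall A B (f : hom A B), comp (idm A) f = f;
  comp_idr : forall A B (f : hom A B), comp f (idm B) = f;
  comp_assoc : forall A B C D (f : hom A B) (g : hom B C) (h : hom C D),
    comp f (comp g h) = comp (comp f g) h
}.
Arguments hom {c} A B.
Arguments idm {c} A.
Arguments comp {c A B C} f g.

(* Left-to-right composition: first [f], then [g]. *)
Notation "f ;; g" := (comp f g) (at level 40, left associativity) : cat_scope.

(* Arrows whose endpoints are only propositionally equal are compared as
   elements of the set of all arrows, that is, together with their endpoints:
   [f == g] says that domains, codomains and arrows all agree. *)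
Record arrow (C : Category) := Arrow {
  arr_dom : C;
  arr_cod : C;
  arr_map : hom arr_dom arr_cod
}.
Arguments Arrow {C arr_dom arr_cod} arr_map.
Notation "f == g" := (Arrow f = Arrow g)
  (at level 70, no associativity) : cat_scope.

Definition recast_dom (C : Category) (A A' B : C) (e : A' = A) (f : hom A B) :
  hom A' B :=
  eq_rect_r (fun D => hom D B) f e.

Record Functor (C D : Category) := {
  fobj :> C -> D;
  fmap : forall X Y, hom X Y -> hom (fobj X) (fobj Y);
  fmap_id : forall X, fmap (idm X) = idm (fobj X);
  fmap_comp : forall X Y Z (f : hom X Y) (g : hom Y Z),
    fmap (f ;; g) = fmap f ;; fmap g
}.
Arguments fmap {C D} _ {X Y} _.

Definition functor_id (C : Category) : Functor C C :=
  {| fobj := fun X => X;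
     fmap := fun X Y f => f;
     fmap_id := fun X => eq_refl;
     fmap_comp := fun X Y Z f g => eq_refl |}.

Definition functor_comp (C D E : Category) (G : Functor D E) (F : Functor C D) :
  Functor C E.
Proof.
refine {| fobj := fun X => G (F X); fmap := fun X Y f => fmap G (fmap F f) |}.
- intros X; rewrite fmap_id; apply fmap_id.
- intros X Y Z f g; rewrite fmap_comp; apply fmap_comp.
Defined.
Notation "G ∘ F" := (functor_comp G F)
  (at level 40, left associativity) : cat_scope.

Record NatTrans (C D : Category) (F G : Functor C D) := {
  nt :> forall X, hom (F X) (G X);
  nt_natural : forall X Y (f : hom X Y), fmap F f ;; nt Y = nt X ;; fmap G f
}.

Record Adjunction (C D : Category) (L : Functor C D) (R : Functor D C) := {
  adj_unit : NatTrans (functor_id C) (R ∘ L);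
  adj_counit : NatTrans (L ∘ R) (functor_id D);
  triangle_left : forall X : C,
    fmap L (adj_unit X) ;; adj_counit (L X) = idm (L X);
  triangle_right : forall Y : D,
    adj_unit (R Y) ;; fmap R (adj_counit Y) = idm (R Y)
}.

Record CatOver (B : Category) := {
  total :> Category;
  proj : Functor total B
}.
Arguments proj {B} c.

Record FunctorOver (B : Category) (X Y : CatOver B) := {
  fun_over :> Functor X Y;
  fun_overP : proj Y ∘ fun_over = proj X
}.

Definition fun_over_ob (B : Category) (X Y : CatOver B) (F : FunctorOver X Y)
  (x : X) : proj Y (F x) = proj X x :=
  f_equal (fun G : Functor X B => G x) (fun_overP F).

Section Over.
Variables (B : Category) (P : CatOver B).

Definition over (X Y : P) (x : hom X Y) (A A' : B) (a : hom A A') : Prop :=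
  fmap (proj P) x == a.

Definition vertical (X Y : P) (x : hom X Y) : Prop :=
  exists A : B, over x (idm A).

Definition cocartesian (X Y : P) (x : hom X Y) (A A' : B) (a : hom A A') :
  Prop :=
  over x a /\
  forall (C : B) (b : hom A' C) (Z : P), proj P Z = C ->
  forall w : hom X Z, over w (a ;; b) ->
  exists! z : hom Y Z, over z b /\ x ;; z = w.

End Over.

Definition vertical_adjunction (B : Category) (X Y : CatOver B)
  (L : FunctorOver X Y) (R : FunctorOver Y X) (adj : Adjunction L R) : Prop :=
  (forall x : X, vertical (adj_unit adj x)) /\
  (forall y : Y, vertical (adj_counit adj y)).

Record lift_choice (B : Category) (P : CatOver B) := {
  push : forall (X : P) (A : B), hom (proj P X) A -> P;
  lift : forall (X : P) (A : B) (a : hom (proj P X) A), hom X (push a)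
}.
Arguments push {B P} _ X {A} a.
Arguments lift {B P} _ X {A} a.

Section Cleavage.
Variables (B : Category) (P : CatOver B) (c : lift_choice P).

Definition cleavage : Prop :=
  forall (X : P) (A : B) (a : hom (proj P X) A), cocartesian (lift c X a) a.

Definition normalized_cleavage : Prop :=
  cleavage /\ forall X : P, lift c X (idm (proj P X)) == idm X.

(* [b'] is [b] with its domain [A] replaced by the equal object
   [proj P (push c X a)]. *)
Definition splitting : Prop :=
  normalized_cleavage /\
  forall (X : P) (A C : B) (a : hom (proj P X) A) (b : hom A C)
    (b' : hom (proj P (push c X a)) C), b' == b ->
    lift c X a ;; lift c (push c X a) b' == lift c X (a ;; b).

End Cleavage.

Definition preserves_lifts (B : Category) (P Q : CatOver B)
  (c : lift_choice P) (d : lift_choice Q) (F : FunctorOver P Q) : Prop :=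
  forall (X : P) (A : B) (a : hom (proj P X) A),
    fmap F (lift c X a) == lift d (F X) (recast_dom (fun_over_ob F X) a).

Lemma functor_eta (C D : Category) (F : Functor C D) i k :
  {| fobj := F; fmap := @fmap C D F; fmap_id := i; fmap_comp := k |} = F.
Proof.
destruct F as [o f i' k']; simpl in *.
rewrite (proof_irrelevance _ i i'), (proof_irrelevance _ k k').
reflexivity.
Qed.

Section T_objects.
Variables (B : Category) (P : CatOver B).

Record T_ob := TOb {
  t_src : P;
  t_tgt : B;
  t_arr : hom (proj P t_src) t_tgt
}.

Record T_hom (p q : T_ob) := THom {
  t_up : hom (t_src p) (t_src q);
  t_down : hom (t_tgt p) (t_tgt q);
  t_comm : fmap (proj P) t_up ;; t_arr q = t_arr p ;; t_down
}.

Lemma T_hom_eq (p q : T_ob) (f g : T_hom p q) :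
  t_up f = t_up g -> t_down f = t_down g -> f = g.
Proof.
destruct f as [x b e], g as [x' b' e']; simpl; intros <- <-.
rewrite (proof_irrelevance _ e e'); reflexivity.
Qed.

Definition T_id (p : T_ob) : T_hom p p.
Proof.
refine (THom (t_up := idm (t_src p)) (t_down := idm (t_tgt p)) _).
rewrite fmap_id, comp_idl, comp_idr; reflexivity.
Defined.

Definition T_comp (p q r : T_ob) (f : T_hom p q) (g : T_hom q r) : T_hom p r.
Proof.
refine (THom (t_up := t_up f ;; t_up g) (t_down := t_down f ;; t_down g) _).
rewrite fmap_comp, <- comp_assoc, (t_comm g), comp_assoc, (t_comm f).
symmetry; apply comp_assoc.
Defined.

Definition T_cat : Category.
Proof.
refine {| ob := T_ob; hom := T_hom; idm := T_id; comp := T_comp |}.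
- intros p q f; apply T_hom_eq; apply comp_idl.
- intros p q f; apply T_hom_eq; apply comp_idr.
- intros p q r s f g h; apply T_hom_eq; apply comp_assoc.
Defined.

Definition T_proj : Functor T_cat B :=
  {| fobj := t_tgt : T_cat -> B;
     fmap := fun p q (f : @hom T_cat p q) => t_down f;
     fmap_id := fun p => eq_refl;
     fmap_comp := fun p q r f g => eq_refl |}.

Definition T : CatOver B := {| total := T_cat; proj := T_proj |}.

Definition y_fun : Functor P T.
Proof.
refine {| fobj := fun X => TOb (idm (proj P X)) : T;
          fmap := fun X Y x =>
            (@THom (TOb (idm (proj P X))) (TOb (idm (proj P Y)))
               x (fmap (proj P) x) _) : @hom T _ _ |}.
- intros X; apply T_hom_eq; [reflexivity | apply fmap_id].
- intros X Y Z f g; apply T_hom_eq; [reflexivity | apply fmap_comp].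
Unshelve.
simpl; rewrite comp_idl, comp_idr; reflexivity.
Defined.

Definition y : FunctorOver P T.
Proof.
exists y_fun.
apply (functor_eta (F := proj P)).
Defined.

(* The arrow ((X,1);a) : (X,1) -> (X,a). *)
Definition y_arrow (X : P) (A : B) (a : hom (proj P X) A) :
  @hom T (y X) (TOb a).
Proof.
refine (@THom (TOb (idm (proj P X))) (TOb a) (idm X) a _).
simpl; rewrite fmap_id; reflexivity.
Defined.

End T_objects.

Lemma recast_square (C D : Category) (G H : Functor C D) (h : G = H)
  (X X' : C) (x : hom X X') (A A' : D) (a : hom (H X) A) (a' : hom (H X') A')
  (b : hom A A') :
  fmap H x ;; a' = a ;; b ->
  fmap G x ;; recast_dom (f_equal (fun K : Functor C D => K X') h) a' =
  recast_dom (f_equal (fun K : Functor C D => K X) h) a ;; b.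
Proof. destruct h; exact (fun e => e). Qed.

Definition T_map_ob (B : Category) (P Q : CatOver B) (F : FunctorOver P Q)
  (p : T P) : T Q :=
  TOb (recast_dom (fun_over_ob F (t_src p)) (t_arr p)).

Definition T_map_hom (B : Category) (P Q : CatOver B) (F : FunctorOver P Q)
  (p q : T P) (f : hom p q) : hom (T_map_ob F p) (T_map_ob F q) :=
  @THom B Q (T_map_ob F p) (T_map_ob F q) (fmap F (t_up f)) (t_down f)
    (recast_square (fun_overP F) (t_comm f)).

Definition T_map_fun (B : Category) (P Q : CatOver B) (F : FunctorOver P Q) :
  Functor (T P) (T Q).
Proof.
refine {| fobj := T_map_ob F : T P -> T Q; fmap := T_map_hom F |}.
- intros p; apply T_hom_eq; [apply fmap_id | reflexivity].
- intros p q r f g; apply T_hom_eq; [apply fmap_comp | reflexivity].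
Defined.

Definition T_map (B : Category) (P Q : CatOver B) (F : FunctorOver P Q) :
  FunctorOver (T P) (T Q).
Proof.
exists (T_map_fun F).
apply (functor_eta (F := proj (T P))).
Defined.

Definition m_ob (B : Category) (P : CatOver B) (p : T (T P)) : T P :=
  TOb (t_arr (t_src p) ;; t_arr p).

Definition m_hom (B : Category) (P : CatOver B) (p q : T (T P)) (f : hom p q) :
  hom (m_ob p) (m_ob q).
Proof.
refine (@THom B P (m_ob p) (m_ob q) (t_up (t_up f)) (t_down f) _).
simpl; rewrite comp_assoc, (t_comm (t_up f)), <- !comp_assoc.
apply f_equal, (t_comm f).
Defined.

Definition m_fun (B : Category) (P : CatOver B) : Functor (T (T P)) (T P).
Proof.
refine {| fobj := @m_ob B P : T (T P) -> T P; fmap := @m_hom B P |};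
  intros; apply T_hom_eq; reflexivity.
Defined.

Definition m (B : Category) (P : CatOver B) : FunctorOver (T (T P)) (T P).
Proof.
exists (m_fun P).
apply (functor_eta (F := proj (T (T P)))).
Defined.

Arguments y {B} P.

Section Algebras.
Variables (B : Category) (P : CatOver B).

Record left_adjoint_to_y (xi : FunctorOver (T P) P) : Prop := {
  ladj_y_unit : xi ∘ y P = functor_id P;
  ladj_y_adj : exists adj : Adjunction xi (y P),
    vertical_adjunction adj /\ forall X : P, adj_counit adj X == idm X
}.

Record strict_T_algebra (xi : FunctorOver (T P) P) : Prop := {
  algebra_unit : xi ∘ y P = functor_id P;
  algebra_assoc : xi ∘ T_map xi = xi ∘ m P
}.

(* X |> a := xi ((X,1);a), whose domain xi (y X) is equal to X. *)
Definition lift_of_functor (xi : FunctorOver (T P) P)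
  (e : xi ∘ y P = functor_id P) : lift_choice P :=
  {| push := fun X A a => xi (TOb a : T P);
     lift := fun X A a =>
       recast_dom
         (eq_sym (f_equal (fun G : Functor P P => G X) e) : X = xi (y P X))
         (fmap xi (y_arrow a)) |}.

(* The functor xi defined by a cleavage: xi(X,a) is the codomain of X |> a, and
   xi(x,beta) is the unique arrow over beta making the square commute. *)
Definition functor_of_lift (c : lift_choice P) (xi : FunctorOver (T P) P) :
  Prop :=
  (forall (X : P) (A : B) (a : hom (proj P X) A),
     xi (TOb a : T P) = push c X a) /\
  (forall (p q : T P) (f : hom p q),
     exists z : hom (push c (t_src p) (t_arr p)) (push c (t_src q) (t_arr q)),
       unique
         (fun z => over z (t_down f) /\
            lift c (t_src p) (t_arr p) ;; z =
            t_up f ;; lift c (t_src q) (t_arr q)) z /\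
       fmap xi f == z).

End Algebras.

(* Main.v *)
(** A lift is recovered from the adjunction as the [X]-component of its unit, so
    the universal property of the unit is the cocartesian property of the lifts.
    Everything else rests on one square: for [f : (X,a) -> (X',a')] in [T X],
    [lift X a ;; xi f = t_up f ;; lift X' a'], which together with
    cocartesianness determines [xi f].  A strict algebra is adjoint to [y]
    because associativity, applied to the arrow [(X,1,a) -> (X,a,1)] of
    [T (T X)], is the nontrivial triangle identity. *)

From Stdlib Require Import ProofIrrelevance FunctionalExtensionality.
From Stdlib Require Import ClassicalEpsilon.
Require Import Defs.

Set Implicit Arguments.
Unset Strict Implicit.
Unset Printing Implicit Defensive.

(** * Arrows compared together with their endpoints *)

(** Splits [==] into endpoint equalities and a transport, so that the endpoints can be eliminated by
    [destruct]. *)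
Lemma arrow_eq_cast (C : Category) (X Y X' Y' : C) (f : hom X Y) (f' : hom X' Y') :
  f == f' ->
  exists (e : X = X') (e' : Y = Y'),
    eq_rect Y (fun D => hom X' D) (eq_rect X (fun D => hom D Y) f X' e) Y' e' = f'.
Proof.
intros h.
(* With [f'] seen only through projections of [Arrow f'], rewriting by [h] replaces both endpoints
   and the arrow at once. *)
change (exists (e : X = arr_dom (Arrow f')) (e' : Y = arr_cod (Arrow f')),
  eq_rect Y (fun D => hom (arr_dom (Arrow f')) D)
    (eq_rect X (fun D => hom D Y) f _ e) _ e' = arr_map (Arrow f')).
rewrite <- h; exists eq_refl, eq_refl; reflexivity.
Qed.

Lemma arrow_eq_inj (C : Category) (X Y : C) (f g : hom X Y) : f == g -> f = g.
Proof.
intros h; destruct (arrow_eq_cast h) as (e & e' & <-).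
rewrite (proof_irrelevance _ e eq_refl), (proof_irrelevance _ e' eq_refl).
reflexivity.
Qed.

Lemma arrow_eq_of_eq (C : Category) (X Y : C) (f g : hom X Y) : f = g -> f == g.
Proof. intros ->; reflexivity. Qed.

Lemma arrow_eq_comp (C : Category) (X Y Z X' Y' Z' : C) (f : hom X Y) (g : hom Y Z)
  (f' : hom X' Y') (g' : hom Y' Z') : f == f' -> g == g' -> f ;; g == f' ;; g'.
Proof.
intros h k; destruct (arrow_eq_cast h) as (e & e' & <-).
destruct e, e'; simpl in *; destruct (arrow_eq_cast k) as (d & d' & <-).
destruct d'; rewrite (proof_irrelevance _ d eq_refl); reflexivity.
Qed.

Lemma arrow_eq_fmap (C D : Category) (F : Functor C D) (X Y X' Y' : C)
  (f : hom X Y) (f' : hom X' Y') : f == f' -> fmap F f == fmap F f'.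
Proof. exact (fun h => f_equal (fun r : arrow C => Arrow (fmap F (arr_map r))) h). Qed.

Lemma arrow_eq_functor (C D : Category) (F G : Functor C D) (X Y : C)
  (f : hom X Y) : F = G -> fmap F f == fmap G f.
Proof. intros ->; reflexivity. Qed.

Lemma arrow_eq_idm (C : Category) (X Y : C) : X = Y -> idm X == idm Y.
Proof. intros ->; reflexivity. Qed.

Lemma arrow_eq_dom (C : Category) (X Y X' Y' : C) (f : hom X Y) (f' : hom X' Y') :
  f == f' -> X = X'.
Proof. exact (fun h => f_equal (@arr_dom C) h). Qed.

Lemma arrow_eq_cod (C : Category) (X Y X' Y' : C) (f : hom X Y) (f' : hom X' Y') :
  f == f' -> Y = Y'.
Proof. exact (fun h => f_equal (@arr_cod C) h). Qed.

Lemma comp_arrow_idr (C : Category) (X Y Z A : C) (f : hom X Y) (g : hom Y Z) :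
  g == idm A -> f ;; g == f.
Proof.
intros h; rewrite <- (comp_idr f) at 2.
apply arrow_eq_comp; [reflexivity | rewrite h].
apply arrow_eq_idm; symmetry; exact (arrow_eq_dom h).
Qed.

Lemma comp_arrow_idl (C : Category) (X Y Z A : C) (f : hom X Y) (g : hom Y Z) :
  f == idm A -> f ;; g == g.
Proof.
intros h; rewrite <- (comp_idl g) at 2.
apply arrow_eq_comp; [rewrite h | reflexivity].
apply arrow_eq_idm; symmetry; exact (arrow_eq_cod h).
Qed.

Lemma recast_domE (C : Category) (A A' B : C) (e : A' = A) (f : hom A B) :
  recast_dom e f == f.
Proof. destruct e; reflexivity. Qed.

Arguments y {B} P.

(** The arrow parts suffice: the value at an object is the domain of the image of its identity. *)
Lemma functor_ext (C D : Category) (F G : Functor C D) :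
  (forall (X Y : C) (f : hom X Y), fmap F f == fmap G f) -> F = G.
Proof.
destruct F as [o f i k], G as [o' f' i' k']; simpl; intros h.
assert (E : o = o').
{ apply functional_extensionality; intros X.
  exact (arrow_eq_dom (h _ _ (idm X))). }
destruct E.
assert (E : f = f').
{ do 3 (apply functional_extensionality_dep; intros ?).
  apply arrow_eq_inj, h. }
destruct E.
rewrite (proof_irrelevance _ i i'), (proof_irrelevance _ k k'); reflexivity.
Qed.

(** The equality of [t_up] identifies the objects of [P], those of [t_arr] the objects of [B]; then
    [T_hom_eq] applies. *)
Lemma T_hom_arrow_eq (B : Category) (P : CatOver B) (p q p' q' : T P)
  (f : hom p q) (f' : hom p' q') :
  t_arr p == t_arr p' -> t_arr q == t_arr q' -> t_up f == t_up f' ->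
  t_down f == t_down f' -> f == f'.
Proof.
destruct p as [X A a], q as [Y D d], p' as [X' A' a'], q' as [Y' D' d'].
simpl in *; intros ha hd hu hv.
pose proof (arrow_eq_dom hu) as e; simpl in e; destruct e.
pose proof (arrow_eq_cod hu) as e; simpl in e; destruct e.
pose proof (arrow_eq_cod ha) as e; simpl in e; destruct e.
pose proof (arrow_eq_cod hd) as e; simpl in e; destruct e.
apply arrow_eq_inj in ha, hd; destruct ha, hd.
apply arrow_eq_of_eq, T_hom_eq; apply arrow_eq_inj; assumption.
Qed.

Lemma fmap_proj_over (B : Category) (P Q : CatOver B) (F : FunctorOver P Q)
  (X Y : P) (f : hom X Y) : fmap (proj Q) (fmap F f) == fmap (proj P) f.
Proof. exact (arrow_eq_functor f (fun_overP F)). Qed.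

(** * Cocartesian arrows and cleavages *)

(** The uniqueness half of cocartesianness, freed from convertible endpoints; it is how two values
    of a functor such as [xi] are shown equal. *)
Lemma cocartesian_cancel (B : Category) (P : CatOver B) (X Y Y' Z Z' : P)
  (A A' : B) (a : hom A A') (u : hom X Y) (u' : hom X Y') (z : hom Y Z)
  (z' : hom Y' Z') :
  cocartesian u a -> u == u' -> fmap (proj P) z == fmap (proj P) z' ->
  u ;; z == u' ;; z' -> z == z'.
Proof.
intros [ho hc] hu hz hw.
pose proof (arrow_eq_cod hu) as e; simpl in e; destruct e.
apply arrow_eq_inj in hu; destruct hu.
pose proof (arrow_eq_cod hw) as e; simpl in e; destruct e.
apply arrow_eq_inj in hw; apply arrow_eq_of_eq.
pose proof (arrow_eq_cod ho) as e; simpl in e; destruct e.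
destruct (hc _ (fmap (proj P) z) Z eq_refl (u ;; z)) as (t & _ & ht).
{ unfold over; rewrite fmap_comp; apply arrow_eq_comp; auto. }
rewrite <- (ht z), <- (ht z'); [reflexivity | |]; split; auto.
- symmetry; exact hz.
- reflexivity.
Qed.

Lemma lift_arrow_eq (B : Category) (P : CatOver B) (c : lift_choice P) (X : P)
  (A A' : B) (a : hom (proj P X) A) (a' : hom (proj P X) A') :
  a == a' -> lift c X a == lift c X a'.
Proof.
intros h; pose proof (arrow_eq_cod h) as e; simpl in e; destruct e.
apply arrow_eq_inj in h; destruct h; reflexivity.
Qed.

Lemma lift_idm (B : Category) (P : CatOver B) (c : lift_choice P) (X : P)
  (A A' : B) (a : hom (proj P X) A) :
  normalized_cleavage c -> a == idm A' -> lift c X a == idm X.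
Proof.
intros [_ hn] h; rewrite <- (hn X); apply lift_arrow_eq; rewrite h.
apply arrow_eq_idm; symmetry; exact (arrow_eq_dom h).
Qed.

(** * From a left adjoint of [y] to a cleavage *)

Section FromAdjoint.
Variables (B : Category) (P : CatOver B) (xi : FunctorOver (T P) P).
Variable e : xi ∘ y P = functor_id P.
Let c : lift_choice P := lift_of_functor e.

Lemma lift_of_functorE (X : P) (A : B) (a : hom (proj P X) A) :
  lift c X a == fmap xi (y_arrow a).
Proof. apply recast_domE. Qed.

Lemma xi_yE (X Y : P) (x : hom X Y) : fmap xi (fmap (y P) x) == x.
Proof. exact (arrow_eq_functor x e). Qed.

(** The square already commutes in [T P], with [y_arrow a] and [y_arrow d] as sides and [y] of
    [t_up f] on top; [xi] carries it to [P], where [xi ∘ y] is the identity. *)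
Lemma lift_square (X Y : P) (A D : B) (a : hom (proj P X) A)
  (d : hom (proj P Y) D) (f : @hom (T P) (TOb a) (TOb d)) :
  lift c X a ;; fmap xi f == t_up f ;; lift c Y d.
Proof.
assert (h : fmap (y P) (t_up f) ;; y_arrow d = y_arrow a ;; f).
{ apply T_hom_eq; simpl.
  - rewrite comp_idl; apply comp_idr.
  - apply (t_comm f). }
transitivity (Arrow (fmap xi (y_arrow a ;; f))).
- rewrite fmap_comp; apply arrow_eq_comp; [apply lift_of_functorE | reflexivity].
- rewrite <- h, fmap_comp; symmetry.
  apply arrow_eq_comp; [symmetry; apply xi_yE | apply lift_of_functorE].
Qed.

Lemma lift_over (X : P) (A : B) (a : hom (proj P X) A) : over (lift c X a) a.
Proof.
unfold over; transitivity (Arrow (fmap (proj P) (fmap xi (y_arrow a)))).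
- apply arrow_eq_fmap, lift_of_functorE.
- apply fmap_proj_over.
Qed.

Lemma lift_normalized (X : P) : lift c X (idm (proj P X)) == idm X.
Proof.
rewrite lift_of_functorE.
transitivity (Arrow (fmap xi (fmap (y P) (idm X)))); [| apply xi_yE].
apply arrow_eq_of_eq, f_equal, T_hom_eq; simpl; [reflexivity |].
symmetry; apply fmap_id.
Qed.

Section Unit.
Variable adj : Adjunction xi (y P).
Hypothesis unit_vertical : forall p : T P, vertical (adj_unit adj p).
Hypothesis counit1 : forall X : P, adj_counit adj X == idm X.

(** Naturality of the unit at [y_arrow a] compares the unit at [(X,a)] with that at [y P X], whose
    upper part is an identity by the right triangle and the identity counit. *)
Lemma lift_unit (X : P) (A : B) (a : hom (proj P X) A) :
  lift c X a = t_up (adj_unit adj (TOb a : T P)).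
Proof.
apply arrow_eq_inj.
pose proof (f_equal (fun f => t_up f) (nt_natural (adj_unit adj) (y_arrow a))) as n.
pose proof (f_equal (fun f => t_up f) (triangle_right adj X)) as t.
simpl in n, t.
rewrite lift_of_functorE; symmetry.
rewrite <- (comp_idl (t_up (adj_unit adj (TOb a : T P)))).
etransitivity; [exact (arrow_eq_of_eq n) |].
apply comp_arrow_idl with (A := X).
transitivity (Arrow (t_up (adj_unit adj (y P X)) ;; adj_counit adj X)).
- symmetry; apply comp_arrow_idr with (1 := counit1 X).
- exact (arrow_eq_of_eq t).
Qed.

Lemma adjoint_normalized_cleavage : normalized_cleavage c.
Proof.
split; [| exact lift_normalized].
intros X A a; split; [apply lift_over |].
intros D b Z <- w hw.
assert (hc : fmap (proj P) w ;; idm (proj P Z) = a ;; b).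
{ rewrite comp_idr; apply arrow_eq_inj, hw. }
(* An arrow [w] over [a ;; b] is the same as an arrow from [(X,a)] to [y P Z] over [b]; the filler
   is its adjoint transpose. *)
set (f := @THom B P (TOb a) (y P Z) w b hc : @hom (T P) (TOb a) (y P Z)).
exists (fmap xi f ;; adj_counit adj Z); split; [split |].
- unfold over; rewrite fmap_comp.
  rewrite (comp_arrow_idr (A := proj P Z)); [apply (fmap_proj_over xi) |].
  rewrite <- fmap_id; apply arrow_eq_fmap, counit1.
- pose proof (f_equal (fun f => t_up f) (nt_natural (adj_unit adj) f)) as n.
  pose proof (f_equal (fun f => t_up f) (triangle_right adj Z)) as t.
  rewrite lift_unit, comp_assoc.
  etransitivity; [exact (f_equal (fun g => g ;; _) (eq_sym n)) |]; simpl.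
  rewrite <- comp_assoc.
  etransitivity; [exact (f_equal (comp w) t) | apply comp_idr].
- intros z [hz <-].
  (* Uniqueness: any filler [z] transposes back to [f], by [lift_unit] above and verticality of the
     unit below. *)
  assert (hf : f = adj_unit adj (TOb a : T P) ;; fmap (y P) z).
  { apply T_hom_eq; [exact (f_equal (fun g => g ;; z) (lift_unit a)) | simpl].
    destruct (unit_vertical (TOb a : T P)) as (A' & k).
    apply arrow_eq_inj; symmetry.
    rewrite (comp_arrow_idl (A := A')); [exact hz | exact k]. }
  rewrite hf, fmap_comp, <- comp_assoc.
  pose proof (nt_natural (adj_counit adj) z) as n; simpl in n.
  etransitivity; [exact (f_equal (comp _) n) |].
  rewrite comp_assoc.
  etransitivity; [exact (f_equal (fun g => g ;; z)
    (triangle_left adj (TOb a : T P))) |].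
  apply comp_idl.
Qed.

End Unit.
End FromAdjoint.

(** Leaving [e] arbitrary lets this serve both [ladj_y_unit] and [algebra_unit]. *)
Lemma left_adjoint_normalized_cleavage (B : Category) (P : CatOver B)
  (xi : FunctorOver (T P) P) (e : xi ∘ y P = functor_id P) :
  left_adjoint_to_y xi -> normalized_cleavage (lift_of_functor e).
Proof.
intros [_ (adj & [hu _] & hc)].
exact (adjoint_normalized_cleavage e hu hc).
Qed.

(** * Strict associativity and splittings *)

Lemma lift_T_map (B : Category) (P Q : CatOver B) (F : FunctorOver P Q)
  (xi : FunctorOver (T Q) Q) (e : xi ∘ y Q = functor_id Q)
  (p q : T P) (f : hom p q) :
  lift (lift_of_functor e) (F (t_src p))
    (recast_dom (fun_over_ob F (t_src p)) (t_arr p)) ;;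
    fmap xi (fmap (T_map F) f)
  == fmap F (t_up f) ;;
    lift (lift_of_functor e) (F (t_src q))
      (recast_dom (fun_over_ob F (t_src q)) (t_arr q)).
Proof. apply (lift_square e (fmap (T_map F) f)). Qed.

Lemma lift_m (B : Category) (P : CatOver B) (xi : FunctorOver (T P) P)
  (e : xi ∘ y P = functor_id P) (p q : T (T P)) (f : hom p q) :
  lift (lift_of_functor e) (t_src (t_src p)) (t_arr (t_src p) ;; t_arr p) ;;
    fmap xi (fmap (m P) f)
  == t_up (t_up f) ;;
    lift (lift_of_functor e) (t_src (t_src q)) (t_arr (t_src q) ;; t_arr q).
Proof. apply (lift_square e (fmap (m P) f)). Qed.

(** Both functors send [f] to a filler of one square on the lift of [a ;; b]: through [m] directly,
    through [T_map xi] by pasting the squares for [a] and for [b], the splitting law identifying the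
    sides. *)
Lemma assoc_of_splitting (B : Category) (P : CatOver B)
  (xi : FunctorOver (T P) P) (e : xi ∘ y P = functor_id P) :
  splitting (lift_of_functor e) -> xi ∘ T_map xi = xi ∘ m P.
Proof.
set (c := lift_of_functor e); intros [[hc _] hs].
apply functor_ext; intros [[X A a] D b] [[X' A' a'] D' b'] f; simpl in a, b, a', b'.
change (fmap xi (fmap (T_map xi) f) == fmap xi (fmap (m P) f)).
symmetry.
assert (hl : forall (X : P) (A D : B) (a : hom (proj P X) A) (b : hom A D),
  lift c X a ;;
    lift c (push c X a) (recast_dom (fun_over_ob xi (TOb a : T P)) b)
  == lift c X (a ;; b)).
{ intros; apply hs, recast_domE. }
apply (cocartesian_cancel (hc _ _ _) (eq_sym (hl X A D a b))).
- transitivity (Arrow (t_down f)); [apply (fmap_proj_over xi (fmap (m P) f)) |].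
  symmetry; apply (fmap_proj_over xi (fmap (T_map xi) f)).
- etransitivity; [apply (lift_m e f) |].
  rewrite <- comp_assoc.
  etransitivity.
  2: { apply arrow_eq_comp; [reflexivity | symmetry; apply (lift_T_map xi e f)]. }
  etransitivity.
  { apply arrow_eq_comp; [reflexivity | symmetry; apply (hl X' A' D' a' b')]. }
  rewrite !comp_assoc.
  apply arrow_eq_comp; [| reflexivity].
  symmetry; apply (lift_square e (t_up f)).
Qed.

Lemma splitting_of_assoc (B : Category) (P : CatOver B)
  (xi : FunctorOver (T P) P) (e : xi ∘ y P = functor_id P) :
  normalized_cleavage (lift_of_functor e) ->
  xi ∘ T_map xi = xi ∘ m P -> splitting (lift_of_functor e).
Proof.
set (c := lift_of_functor e); intros hc ha; split; [exact hc |].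
intros X A D a b b' hb.
(* [f] goes from [(X,a,1)] to [(X,a,b)] in [T (T P)]. *)
pose (f := y_arrow (P := T P) (X := TOb a) b).
assert (h : fmap xi (fmap (m P) f) == lift c (push c X a) b').
{ etransitivity; [symmetry; exact (arrow_eq_functor f ha) |].
  pose proof (lift_T_map xi e f) as h.
  (* The lift prepended here is along a recast identity, hence an identity by normalization; the
     square for [T_map xi] then reduces to the lift of [b']. *)
  etransitivity; [symmetry; eapply comp_arrow_idl |].
  2: { etransitivity; [exact h |].
    etransitivity; [eapply comp_arrow_idl; simpl; rewrite fmap_id; reflexivity |].
    apply lift_arrow_eq; rewrite hb; apply recast_domE. }
  apply (lift_idm hc (recast_domE _ _)). }
transitivity (Arrow (lift c X (a ;; idm A) ;; fmap xi (fmap (m P) f))).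
{ apply arrow_eq_comp; [rewrite comp_idr; reflexivity | symmetry; exact h]. }
etransitivity; [apply (lift_m e f) |].
apply comp_arrow_idl with (A := X); reflexivity.
Qed.

(** * From a cleavage to a left adjoint of [y] *)

(** Common to strict algebras and cleavages: [u] gives the upper part of the unit. The last
    hypothesis is the left triangle identity, quantified over [h] because the lower part of the unit
    is built only in the proof. *)
Lemma left_adjoint_of_lifts (B : Category) (P : CatOver B)
  (xi : FunctorOver (T P) P) (e : xi ∘ y P = functor_id P)
  (u : forall p : T P, hom (t_src p) (xi p)) :
  (forall p : T P, over (u p) (t_arr p)) ->
  (forall (p q : T P) (f : hom p q), u p ;; fmap xi f = t_up f ;; u q) ->
  (forall X : P, u (y P X) == idm X) ->
  (forall (p : T P) (h : hom p (y P (xi p))), t_up h = u p ->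
     t_down h == idm (t_tgt p) -> fmap xi h == idm (xi p)) ->
  left_adjoint_to_y xi.
Proof.
intros hover hnat hid htri; split; [exact e |].
(* The objects compared by [eX] and [eA] are only propositionally equal, so the counit and the lower
   part of the unit are recast identities. *)
pose (eX := fun X : P => f_equal (fun G : Functor P P => G X) e : xi (y P X) = X).
pose (eA := fun p : T P => fun_over_ob xi p : proj P (xi p) = t_tgt p).
pose (eps := fun X : P => recast_dom (eX X) (idm X) : hom (xi (y P X)) X).
pose (d := fun p : T P => recast_dom (eq_sym (eA p)) (idm (proj P (xi p)))
  : hom (t_tgt p) (proj P (xi p))).
assert (epsE : forall X, eps X == idm X) by (intros X; apply recast_domE).
assert (dE : forall p, d p == idm (t_tgt p)).
{ intros p; etransitivity; [apply recast_domE | apply arrow_eq_idm, eA]. }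
assert (comm : forall p, fmap (proj P) (u p) ;; idm (proj P (xi p)) = t_arr p ;; d p).
{ intros p; rewrite comp_idr; apply arrow_eq_inj.
  etransitivity; [apply hover |].
  symmetry; eapply comp_arrow_idr, dE. }
pose (eta := fun p : T P =>
  (@THom B P p (y P (xi p)) (u p) (d p) (comm p)) : hom p (y P (xi p))).
assert (etaN : forall (p q : T P) (f : hom p q),
  f ;; eta q = eta p ;; fmap (y P) (fmap xi f)).
{ intros p q f; apply T_hom_eq; simpl; [symmetry; apply hnat |].
  apply arrow_eq_inj.
  etransitivity; [eapply comp_arrow_idr, dE |].
  symmetry; etransitivity; [eapply comp_arrow_idl, dE |].
  apply (fmap_proj_over xi f). }
assert (epsN : forall (X Y : P) (x : hom X Y),
  fmap xi (fmap (y P) x) ;; eps Y = eps X ;; x).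
{ intros X Y x; apply arrow_eq_inj.
  etransitivity; [eapply comp_arrow_idr, epsE |].
  symmetry; etransitivity; [eapply comp_arrow_idl, epsE |].
  symmetry; apply xi_yE, e. }
assert (tl : forall p : T P, fmap xi (eta p) ;; eps (xi p) = idm (xi p)).
{ intros p; apply arrow_eq_inj.
  etransitivity; [eapply comp_arrow_idr, epsE |].
  apply htri; [reflexivity | apply dE]. }
assert (tr : forall X : P, eta (y P X) ;; fmap (y P) (eps X) = idm (y P X)).
{ intros X; apply T_hom_eq; apply arrow_eq_inj.
  - etransitivity; [eapply comp_arrow_idl, hid | apply epsE].
  - etransitivity; [eapply comp_arrow_idl, dE |].
    etransitivity; [apply arrow_eq_fmap, epsE |].
    simpl; rewrite fmap_id; reflexivity. }
pose (unit := {| nt := eta : forall p : T P, hom (functor_id (T P) p) ((y P ∘ xi) p);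
  nt_natural := etaN |} : NatTrans (functor_id (T P)) (y P ∘ xi)).
pose (counit := {| nt := eps : forall X : P, hom ((xi ∘ y P) X) (functor_id P X);
  nt_natural := epsN |} : NatTrans (xi ∘ y P) (functor_id P)).
exists (@Build_Adjunction _ _ xi (y P) unit counit tl tr).
split; [split |]; simpl.
- intros p; exists (t_tgt p); apply dE.
- intros X; exists (proj P X); unfold over.
  etransitivity; [apply arrow_eq_fmap, epsE | rewrite fmap_id; reflexivity].
- exact epsE.
Qed.

Lemma strict_algebra_left_adjoint (B : Category) (P : CatOver B)
  (xi : FunctorOver (T P) P) : strict_T_algebra xi -> left_adjoint_to_y xi.
Proof.
intros [e ha].
pose (c := lift_of_functor e).
(* For a variable [p] the lift ends at [xi (TOb (t_arr p))] rather than [xi p]; [cl] supplies its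
   copy with the right codomain. *)
assert (cl : forall p : T P,
  {u : hom (t_src p) (xi p) | u == lift c (t_src p) (t_arr p)}).
{ intros [X A a]; exists (lift c X a); reflexivity. }
apply (left_adjoint_of_lifts e (u := fun p => proj1_sig (cl p))).
- intros p; destruct (cl p) as [u hu]; simpl.
  etransitivity; [apply arrow_eq_fmap, hu | apply lift_over].
- intros p q f; destruct (cl p) as [u hu], (cl q) as [v hv]; simpl.
  apply arrow_eq_inj.
  transitivity (Arrow (t_up f ;; lift c (t_src q) (t_arr q))).
  2: { apply arrow_eq_comp; [reflexivity | symmetry; exact hv]. }
  destruct p as [X A a], q as [Y D d].
  etransitivity; [| exact (lift_square e f)].
  apply arrow_eq_comp; [exact hu | reflexivity].
- intros X; destruct (cl (y P X)) as [u hu]; simpl.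
  etransitivity; [exact hu | apply lift_normalized].
- intros p h; destruct (cl p) as [u hu]; simpl; intros hup hdown.
  destruct p as [X A a].
  (* [f] is the arrow from [(X,1,a)] to [(X,a,1)]: [T_map xi] sends it to [h], and [m] sends it to
     the identity of [(X,a)]. *)
  pose (p1 := @TOb B (T P) (y P X) A a : T (T P)).
  pose (p2 := @TOb B (T P) (TOb a : T P) A (idm A) : T (T P)).
  pose (f := @THom B (T P) p1 p2 (y_arrow a) (idm A) eq_refl : hom p1 p2).
  transitivity (Arrow (fmap xi (fmap (T_map xi) f))).
  + apply arrow_eq_fmap; apply T_hom_arrow_eq; simpl.
    * symmetry; apply recast_domE.
    * symmetry; etransitivity; [apply recast_domE | apply arrow_eq_idm].
      symmetry; apply (fun_over_ob xi).
    * etransitivity; [exact (arrow_eq_of_eq hup) |].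
      etransitivity; [exact hu | apply lift_of_functorE].
    * exact hdown.
  + etransitivity; [exact (arrow_eq_functor f ha) |].
    transitivity (Arrow (fmap xi (idm (TOb a : T P)))).
    2: { rewrite fmap_id; reflexivity. }
    apply (arrow_eq_fmap xi (f := fmap (m P) f)).
    apply T_hom_arrow_eq; simpl; try reflexivity.
    * rewrite comp_idl; reflexivity.
    * rewrite comp_idr; reflexivity.
Qed.

(** * Homomorphisms and preservation of lifts *)

Lemma homomorphism_iff_preserves_lifts (B : Category) (P Q : CatOver B)
  (xi : FunctorOver (T P) P) (xi' : FunctorOver (T Q) Q)
  (e : xi ∘ y P = functor_id P) (e' : xi' ∘ y Q = functor_id Q)
  (F : FunctorOver P Q) :
  normalized_cleavage (lift_of_functor e') ->
  F ∘ xi = xi' ∘ T_map F <->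
  preserves_lifts (lift_of_functor e) (lift_of_functor e') F.
Proof.
intros hc; split.
(* The homomorphism equation is evaluated at [y_arrow a]; as above, normalization removes the lift
   of an identity from the square in [Q]. *)
- intros h X A a.
  etransitivity; [apply arrow_eq_fmap, lift_of_functorE |].
  etransitivity; [exact (arrow_eq_functor (y_arrow a) h) |].
  pose proof (lift_T_map F e' (y_arrow a)) as k.
  etransitivity; [symmetry; eapply comp_arrow_idl |].
  2: { etransitivity; [exact k |].
    eapply comp_arrow_idl; simpl; rewrite fmap_id; reflexivity. }
  apply (lift_idm hc (recast_domE _ _)).
(* Since [F] preserves lifts, both values at [f] fill the same square on a cocartesian lift in
   [Q]. *)
- intros h; apply functor_ext; intros [X A a] [Y D d] f.
  change (fmap F (fmap xi f) == fmap xi' (fmap (T_map F) f)).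
  symmetry; eapply cocartesian_cancel;
    [apply (proj1 hc) | symmetry; apply (h X A a) | |].
  + etransitivity; [apply (fmap_proj_over xi') |].
    symmetry; etransitivity; [apply (fmap_proj_over F) |].
    apply (fmap_proj_over xi).
  + etransitivity; [apply (lift_T_map F e' f) |].
    etransitivity.
    { apply arrow_eq_comp; [reflexivity | symmetry; apply (h Y D d)]. }
    rewrite <- !fmap_comp; symmetry; apply arrow_eq_fmap, (lift_square e f).
Qed.

(** * The functor defined by a normalized cleavage *)

Section FunctorOfCleavage.
Variables (B : Category) (P : CatOver B) (c : lift_choice P).
Hypothesis hc : normalized_cleavage c.

Definition cleavage_ob (p : T P) : P := push c (t_src p) (t_arr p).

Definition cleavage_lift (p : T P) : hom (t_src p) (cleavage_ob p) :=
  lift c (t_src p) (t_arr p).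

Definition cleavage_square (p q : T P) (f : hom p q)
  (z : hom (cleavage_ob p) (cleavage_ob q)) : Prop :=
  over z (t_down f) /\ cleavage_lift p ;; z = t_up f ;; cleavage_lift q.

Lemma cleavage_fill_unique (p q : T P) (f : hom p q) :
  exists! z, cleavage_square f z.
Proof.
destruct (proj1 hc (t_src p) _ (t_arr p)) as [_ hu].
destruct (proj1 hc (t_src q) _ (t_arr q)) as [ho _].
apply hu.
- exact (arrow_eq_cod ho).
- unfold over; rewrite fmap_comp, <- (t_comm f).
  apply arrow_eq_comp; [reflexivity | exact ho].
Qed.

(** Description extracts an arrow from the propositional [exists!]; uniqueness makes the choice
    canonical. *)
Definition cleavage_fill (p q : T P) (f : hom p q) :
  hom (cleavage_ob p) (cleavage_ob q) :=
  proj1_sig (constructive_indefinite_description _ (cleavage_fill_unique f)).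

Lemma cleavage_fillP (p q : T P) (f : hom p q) :
  unique (cleavage_square f) (cleavage_fill f).
Proof. exact (proj2_sig (constructive_indefinite_description _ _)). Qed.

Lemma cleavage_fillE (p q : T P) (f : hom p q)
  (z : hom (cleavage_ob p) (cleavage_ob q)) :
  cleavage_square f z -> cleavage_fill f = z.
Proof. apply cleavage_fillP. Qed.

Lemma cleavage_ob_over (p : T P) : proj P (cleavage_ob p) = t_tgt p.
Proof. exact (arrow_eq_cod (proj1 (proj1 hc (t_src p) _ (t_arr p)))). Qed.

Definition cleavage_functor : Functor (T P) P.
Proof.
refine {| fobj := cleavage_ob : T P -> P; fmap := cleavage_fill |}.
(* Functoriality is uniqueness of fillers: identities and composites of fillers fill the required
   squares. *)
- intros p; apply cleavage_fillE; split.
  + unfold over; rewrite fmap_id; apply arrow_eq_idm, cleavage_ob_over.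
  + simpl; rewrite comp_idl; apply comp_idr.
- intros p q r f g; apply cleavage_fillE.
  destruct (cleavage_fillP f) as [[fo fs] _], (cleavage_fillP g) as [[go gs] _].
  split.
  + unfold over; rewrite fmap_comp; apply arrow_eq_comp; assumption.
  + simpl; rewrite comp_assoc, fs, <- !comp_assoc, gs; reflexivity.
Defined.

Definition cleavage_functor_over : FunctorOver (T P) P.
Proof.
exists cleavage_functor.
apply functor_ext; intros p q f; apply (cleavage_fillP f).
Defined.

Lemma cleavage_functor_of_lift : functor_of_lift c cleavage_functor_over.
Proof.
split; [reflexivity |].
intros p q f; exists (cleavage_fill f); split; [apply cleavage_fillP | reflexivity].
Qed.

(** On arrows in the image of [y], normalization makes both lifts in the defining square
    identities. *)
Lemma cleavage_functor_unit : cleavage_functor_over ∘ y P = functor_id P.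
Proof.
apply functor_ext; intros X Y x.
change (cleavage_fill (fmap (y P) x) == x).
destruct (cleavage_fillP (fmap (y P) x)) as [[_ h] _].
etransitivity; [symmetry; eapply comp_arrow_idl, (proj2 hc X) |].
etransitivity; [exact (arrow_eq_of_eq h) |].
eapply comp_arrow_idr, (proj2 hc Y).
Qed.

Lemma cleavage_functor_left_adjoint : left_adjoint_to_y cleavage_functor_over.
Proof.
apply (left_adjoint_of_lifts cleavage_functor_unit (u := cleavage_lift)).
- intros p; apply hc.
- intros p q f; apply cleavage_fillP.
- apply hc.
- intros p h hup hdown.
  change (cleavage_fill h == idm (cleavage_ob p)).
  destruct (cleavage_fillP h) as [[ho hs] _].
  (* By [hid] the square of [h] ends in an identity, so its filler and the identity agree after the
     cocartesian lift of [p]. *)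
  assert (hid : cleavage_lift (y P (cleavage_ob p)) == idm (cleavage_ob p)) by apply hc.
  apply (cocartesian_cancel (proj1 hc _ _ (t_arr p)) eq_refl).
  + etransitivity; [exact ho |].
    rewrite fmap_id; etransitivity; [exact hdown |].
    symmetry; apply arrow_eq_idm, cleavage_ob_over.
  + etransitivity; [exact (arrow_eq_of_eq hs) |].
    rewrite hup, comp_idr; eapply comp_arrow_idr, hid.
Qed.

End FunctorOfCleavage.

Theorem theorem6p1 (B : Category) :
  (forall (X : CatOver B) (xi : FunctorOver (T X) X) (H : left_adjoint_to_y xi),
     normalized_cleavage (lift_of_functor (ladj_y_unit H))) /\
  (forall (X : CatOver B) (c : lift_choice X), normalized_cleavage c ->
     exists xi : FunctorOver (T X) X, functor_of_lift c xi /\ left_adjoint_to_y xi) /\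
  (forall (X : CatOver B) (xi : FunctorOver (T X) X) (H : left_adjoint_to_y xi),
     splitting (lift_of_functor (ladj_y_unit H)) <->
     xi ∘ T_map xi = xi ∘ m X) /\
  (forall (X X' : CatOver B)
     (xi : FunctorOver (T X) X) (xi' : FunctorOver (T X') X')
     (H : strict_T_algebra xi) (H' : strict_T_algebra xi')
     (F : FunctorOver X X'),
     F ∘ xi = xi' ∘ T_map F <->
     preserves_lifts (lift_of_functor (algebra_unit H))
       (lift_of_functor (algebra_unit H')) F).
Proof.
split; [| split; [| split]].
- intros X xi H; exact (left_adjoint_normalized_cleavage _ H).
- intros X c hc; exists (cleavage_functor_over hc); split.
  + apply cleavage_functor_of_lift.
  + apply cleavage_functor_left_adjoint.
- intros X xi H; split; [apply assoc_of_splitting |].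
  apply splitting_of_assoc, left_adjoint_normalized_cleavage, H.
- intros X X' xi xi' H H' F.
  (* The lifts of [xi'] form a normalized cleavage because a strict algebra is left adjoint to
     [y]. *)
  apply homomorphism_iff_preserves_lifts, left_adjoint_normalized_cleavage.
  apply strict_algebra_left_adjoint, H'.
Qed.
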